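(* Let $\Omega$ be a non-empty set, let $\lambda:\Omega\to[0,1]$ be a possibility distribution on $\Omega$, and let $P_\lambda$ be the possibility measure induced by $\lambda$. Let $\Psi(n)$, $n\in\mathbb{N}=\{1,2,\dots\}$, be real numbers such that $\Psi(n)>0$ for all $n\in\mathbb{N}$ and $\Psi(n)\to\infty$ as $n\to\infty$. Suppose that the sequence of functions $X_k:\Omega\to\mathbb{R}$, $k\in\mathbb{N}$, satisfies $$\max\{Var_{sup}(X_1),\dots,Var_{sup}(X_n)\}\le C\cdot\frac{n^2}{\Psi(n)}\quad\text{for all } n\in\mathbb{N},$$ with $C>0$ a constant independent of $n$. Denote $M_n(\omega)=\max\{X_1(\omega),\dots,X_n(\omega)\}$, $\omega\in\Omega$. Then, as $n\to\infty$, $\frac{M_n-E_{sup}(M_n)}{n}\to 0$ almost everywhere with respect to the possibility measure $P_\lambda$; that is, $$P_\lambda\left(\left\{\omega\in\Omega:\frac{M_n(\omega)-E_{sup}(M_n)}{n}\not\to 0\right\}\right)=0,$$ and also $$P_\lambda\left(\left\{\omega\in\Omega:\lim_{n\to\infty}\frac{M_n(\omega)-E_{sup}(M_n)}{n}=0\right\}\right)=1.$$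
   Context: A possibility distribution on a non-empty set $\Omega$ is a function $\lambda:\Omega\to[0,1]$ with $\sup\{\lambda(s):s\in\Omega\}=1$. It induces the possibility measure $P_\lambda:\mathcal{P}(\Omega)\to[0,1]$ (defined on all subsets of $\Omega$) given by $P_\lambda(A)=\sup\{\lambda(s):s\in A\}$ for $A\subset\Omega$, with $P_\lambda(\emptyset)=0$. For a function $X:\Omega\to\mathbb{R}$, the possibility expectation is $E_{sup}(X)=\sup_{s\in\Omega}X(s)\lambda(s)$, and the possibility variance is $Var_{sup}(X)=\sup\{(X(s)-E_{sup}(X))^2\lambda(s):s\in\Omega\}$. The possibility variance is defined for $X$ with $E_{sup}(X)$ finite, so the assumed bound on $Var_{sup}(X_k)$ is understood to include that each $E_{sup}(X_k)$ is a finite real number. Functions $Y_n:\Omega\to\mathbb{R}$ converge to $Y:\Omega\to\mathbb{R}$ almost everywhere with respect to $P_\lambda$ if $P_\lambda(\{\omega\in\Omega:Y_n(\omega)\not\to Y(\omega)\})=0$, where $Y_n(\omega)\not\to Y(\omega)$ means that $(Y_n(\omega))_n$ either has no limit or has a limit different from $Y(\omega)$. *)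

(* Defs.v *)
From HB Require Import structures.
From mathcomp Require Import all_boot all_order all_algebra.
From mathcomp Require Import all_classical all_reals all_analysis.

Set Implicit Arguments.
Unset Strict Implicit.
Unset Printing Implicit Defensive.

Import Order.TTheory GRing.Theory Num.Theory.
Import numFieldNormedType.Exports.

Local Open Scope classical_set_scope.
Local Open Scope ring_scope.

Definition possibility_distribution (R : realType) (Omega : Type)
    (lam : Omega -> R) : Prop :=
  (forall s, 0 <= lam s <= 1) /\ sup (range lam) = 1.

(* The real supremum satisfies [sup set0 = 0] (lemma [sup0]), which is the
   convention P(empty) = 0; for nonempty [A] the set is bounded in [0, 1]. *)
Definition possibility_measure (R : realType) (Omega : Type)
    (lam : Omega -> R) (A : set Omega) : R :=
  sup (lam @` A).

Definition poss_expectation (R : realType) (Omega : Type)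
    (lam X : Omega -> R) : \bar R :=
  ereal_sup (range (fun s => (X s * lam s)%:E)).

(* Meaningful when the expectation of [X] is finite; [fine] then extracts its
   real value. The variance itself may be [+oo]. *)
Definition poss_variance (R : realType) (Omega : Type)
    (lam X : Omega -> R) : \bar R :=
  ereal_sup (range (fun s =>
    ((X s - fine (poss_expectation lam X)) ^+ 2 * lam s)%:E)).

(* max {x 1, ..., x n} for n >= 1; sequences are indexed from 1, and the
   values at index 0 are irrelevant. *)
Definition running_max (d : Order.disp_t) (T : orderType d)
    (x : nat -> T) (n : nat) : T :=
  \big[Order.max/x 1%N]_(1 <= k < n.+1) x k.

Definition pointwise_running_max (R : realType) (Omega : Type)
    (X : nat -> Omega -> R) (n : nat) (w : Omega) : R :=
  running_max (X ^~ w) n.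

Definition poss_ae_cvg (R : realType) (Omega : Type) (lam : Omega -> R)
    (Y : nat -> Omega -> R) (Y0 : Omega -> R) : Prop :=
  possibility_measure lam
    [set w | ~ (Y n w @[n --> \oo] --> Y0 w)] = 0.

(* Finiteness of the expectation is preserved by finite maxima, so applying
   [fine] to the expectation of a running maximum loses nothing. *)
Lemma poss_expectation_running_max_fin_num (R : realType) (Omega : Type)
    (lam : Omega -> R) (X : nat -> Omega -> R) (n : nat) :
  possibility_distribution lam ->
  (forall k, (0 < k)%N -> poss_expectation lam (X k) \is a fin_num) ->
  poss_expectation lam (pointwise_running_max X n) \is a fin_num.
Proof.
move=> [lam01 sup1] EX.
have /set0P[_ [s _ _]] : range lam != set0.
  by apply/eqP => l0; move/eqP: sup1; rewrite l0 sup0 eq_sym oner_eq0.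
have [B XB] : exists B : R, forall w k, (0 < k <= n.+1)%N ->
    X k w * lam w <= B.
  exists (\sum_(1 <= k < n.+2) `|fine (poss_expectation lam (X k))|).
  move=> w k kn; have k0 : (0 < k)%N by case/andP: kn.
  rewrite (bigD1_seq k) ?iota_uniq ?mem_index_iota //.
  rewrite -[leLHS]addr0 lerD ?sumr_ge0 //.
  apply: (le_trans _ (ler_norm _)).
  rewrite -lee_fin fineK ?EX //.
  by apply: ereal_sup_ubound; exists w.
apply/fin_numPlt/andP; split.
  apply: (@lt_le_trans _ _ (pointwise_running_max X n s * lam s)%:E).
    exact: ltNyr.
  by apply: ereal_sup_ubound; exists s.
apply: (@le_lt_trans _ _ B%:E); last exact: ltry.
apply: ge_ereal_sup => _ [w _ <-]; rewrite lee_fin.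
rewrite /pointwise_running_max /running_max big_seq.
elim/big_ind: _ => [|x y xB yB|k]; first exact: XB.
  by rewrite /Order.max; case: ifP.
by rewrite mem_index_iota => /andP[k0 kn]; apply: XB; rewrite k0 ltnW.
Qed.

(* Main.v *)
Require Import Defs.
From HB Require Import structures.
From mathcomp Require Import all_boot all_order all_algebra.
From mathcomp Require Import all_classical all_reals all_analysis.
From mathcomp Require Import ring.

Set Implicit Arguments.
Unset Strict Implicit.
Unset Printing Implicit Defensive.

Import Order.TTheory GRing.Theory Num.Theory.
Import numFieldNormedType.Exports.

Local Open Scope classical_set_scope.
Local Open Scope ring_scope.

(* For nonnegative [lam], the possibility expectation of a maximum is the maximum
   of the expectations.  Hence at every point where [lam] is positive the
   variance bounds control the deviation of [M_n] from its expectation by that of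
   the [X_k], with no union bound, and the convergence holds at each such point. *)

Lemma le_running_max (d : Order.disp_t) (T : orderType d) (x : nat -> T)
    (n k : nat) :
  (0 < k <= n)%N -> (x k <= running_max x n)%O.
Proof.
move=> /andP[k0 kn]; rewrite /running_max.
by apply: le_bigmax_seq; rewrite // mem_index_iota k0.
Qed.

Lemma running_max_attained (d : Order.disp_t) (T : orderType d) (x : nat -> T)
    (n : nat) :
  (0 < n)%N -> exists2 k, (0 < k <= n)%N & running_max x n = x k.
Proof.
move=> n0; rewrite /running_max big_seq.
elim/big_ind: _ => [|y z [i iP ->] [j jP ->]|k].
- by exists 1%N.
- by rewrite /Order.max; case: ifP; [exists j | exists i].
- by rewrite mem_index_iota ltnS; exists k.
Qed.

Section possibility.
Variables (R : realType) (Omega : Type) (lam : Omega -> R).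
Hypothesis lam_distr : possibility_distribution lam.

Lemma possibility_measure_eq0 (A : set Omega) :
  (forall w, A w -> lam w = 0) -> possibility_measure lam A = 0.
Proof.
move=> A0; rewrite /possibility_measure.
have [->|/set0P[w Aw]] := eqVneq A set0; first by rewrite image_set0 sup0.
rewrite (_ : lam @` A = [set 0]) ?sup1 //.
by apply/seteqP; split=> [_ [v Av <-]|_ ->]; [exact: A0|exists w; rewrite ?A0].
Qed.

(** Points outside [A] have weight zero, so dropping them does not lower the supremum of [lam],
    which is 1. *)
Lemma possibility_measure_eq1 (A : set Omega) :
  (forall w, 0 < lam w -> A w) -> possibility_measure lam A = 1.
Proof.
have [lam01 suplam] := lam_distr; move=> posA.
have ubA : has_ubound (lam @` A).
  by exists 1 => _ [w _ <-]; case/andP: (lam01 w).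
have range0 : range lam !=set0.
  apply/set0P/eqP => l0; move/eqP: suplam.
  by rewrite l0 sup0 eq_sym oner_eq0.
(* This point shows that [A] is nonempty, and its weight dominates that of every point where [lam]
   vanishes, including those outside [A]. *)
have [w lamw] : exists w, 0 < lam w.
  have [|_ [w _ <-] ?] := @sup_gt _ (range lam) 0 range0; last by exists w.
  by rewrite suplam.
apply/eqP; rewrite eq_le; apply/andP; split.
  apply: ge_sup; first by exists (lam w), w => //; exact: posA.
  by move=> _ [v _ <-]; case/andP: (lam01 v).
rewrite -suplam; apply: ge_sup => // _ [v _ <-].
have [v0|v0] := leP (lam v) 0.
  rewrite (le_trans v0)// (le_trans (ltW lamw))//.
  by apply: ub_le_sup => //; exists w => //; exact: posA.
by apply: ub_le_sup => //; exists v => //; exact: posA.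
Qed.

Lemma le_fine_poss_expectation (Y : Omega -> R) (s : Omega) :
  poss_expectation lam Y \is a fin_num ->
  Y s * lam s <= fine (poss_expectation lam Y).
Proof.
by move=> Yfin; rewrite -lee_fin fineK//; apply: ereal_sup_ubound; exists s.
Qed.

Lemma fine_poss_expectation_le (Y : Omega -> R) (B : R) :
  poss_expectation lam Y \is a fin_num ->
  (forall s, Y s * lam s <= B) -> fine (poss_expectation lam Y) <= B.
Proof.
move=> Yfin YB; rewrite -lee_fin fineK//.
by apply: ge_ereal_sup => _ [s _ <-]; rewrite lee_fin.
Qed.

Lemma poss_variance_ge (Y : Omega -> R) (w : Omega) :
  (((Y w - fine (poss_expectation lam Y)) ^+ 2 * lam w)%:E
     <= poss_variance lam Y)%E.
Proof. by apply: ereal_sup_ubound; exists w. Qed.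

(** Each inequality passes through a single index attaining a maximum, so [delta] is not multiplied
    by the number of functions. *)
Lemma running_max_deviation (X : nat -> Omega -> R) (n : nat) (w : Omega)
    (delta : R) :
  (forall k, (0 < k)%N -> poss_expectation lam (X k) \is a fin_num) ->
  (0 < n)%N ->
  (forall k, (0 < k <= n)%N ->
     `|X k w - fine (poss_expectation lam (X k))| <= delta) ->
  `|pointwise_running_max X n w
    - fine (poss_expectation lam (pointwise_running_max X n))| <= delta.
Proof.
have [lam01 _] := lam_distr; move=> Xfin n0 Xdelta.
have Mfin := poss_expectation_running_max_fin_num n lam_distr Xfin.
rewrite ler_distl; apply/andP; split.
  (* Here [k] attains the maximum at [s] and may vary with [s]: the weighted value at [s] is at most
     the expectation of [X k], hence at most [X k w + delta]. *)
  rewrite lerBlDr; apply: fine_poss_expectation_le => // s.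
  have [k kn Mk] := running_max_attained (X ^~ s) n0.
  rewrite [pointwise_running_max X n s]Mk {Mk}.
  have k0 : (0 < k)%N by case/andP: kn.
  apply: (le_trans (le_fine_poss_expectation s (Xfin k k0))).
  have := Xdelta k kn; rewrite ler_distlC => /andP[_ /le_trans]; apply.
  by rewrite lerD2r (le_running_max (X ^~ w)).
(* Now [k] attains the maximum at [w] itself; since [lam] is nonnegative, the expectation of [X k]
   is at most that of the maximum. *)
have [k kn Mk] := running_max_attained (X ^~ w) n0.
rewrite [pointwise_running_max X n w]Mk {Mk}.
have k0 : (0 < k)%N by case/andP: kn.
have := Xdelta k kn; rewrite ler_distl => /andP[_ /le_trans]; apply.
rewrite lerD2r; apply: fine_poss_expectation_le => [|s]; first exact: Xfin.
apply: le_trans (le_fine_poss_expectation s Mfin).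
by rewrite ler_wpM2r ?(le_running_max (X ^~ s))//; case/andP: (lam01 s).
Qed.

End possibility.

Theorem theorem3p3 (R : realType) (Omega : Type) (lam : Omega -> R)
    (Psi : nat -> R) (X : nat -> Omega -> R) (C : R)
    (Omega_neq0 : [set: Omega] !=set0)
    (lam_distr : possibility_distribution lam)
    (Psi_gt0 : forall n, (0 < n)%N -> 0 < Psi n)
    (Psi_infty : Psi n @[n --> \oo] --> +oo)
    (C_gt0 : 0 < C)
    (EX_fin : forall k, (0 < k)%N -> poss_expectation lam (X k) \is a fin_num)
    (VarX_le : forall n, (0 < n)%N ->
       (running_max (fun k => poss_variance lam (X k)) n
          <= (C * (n%:R ^+ 2 / Psi n))%:E)%E) :
  let M := pointwise_running_max X in
  poss_ae_cvg lam
    (fun n w => (M n w - fine (poss_expectation lam (M n))) / n%:R)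
    (fun=> 0) /\
  possibility_measure lam
    [set w | (M n w - fine (poss_expectation lam (M n))) / n%:R
               @[n --> \oo] --> (0 : R)] = 1.
Proof.
move=> M.
(* Both claims follow from convergence wherever [lam] is positive, since the exceptional points then
   all have weight zero. *)
suff cvgM w : 0 < lam w ->
    (M n w - fine (poss_expectation lam (M n))) / n%:R @[n --> \oo] --> (0 : R).
  split; last exact: possibility_measure_eq1.
  apply: possibility_measure_eq0 => w /= ncvg; apply/eqP.
  have [/(_ w)/andP[lam0 _] _] := lam_distr.
  by rewrite eq_le lam0 andbT leNgt; apply/negP => /cvgM.
move=> lamw; apply/cvgr0Pnorm_le => e e0.
(* The threshold solves [C * n^2 / Psi n <= (e * n)^2 * lam w], in which [n^2] cancels. It may
   depend on [w], as convergence is only pointwise. *)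
have Psi_large : \forall n \near \oo, C / (e ^+ 2 * lam w) <= Psi n.
  by move/cvgryPge: Psi_infty; apply.
near=> n.
have n0 : (0 < n)%N by near: n; exact: nbhs_infty_gt.
have nR : 0 < n%:R :> R by rewrite ltr0n.
rewrite normrM normfV (gtr0_norm nR) ler_pdivrMr//.
apply: (running_max_deviation lam_distr) => // k kn.
have en0 : 0 <= e * n%:R by rewrite ltW// mulr_gt0.
(* Squaring and weighting by [lam w > 0] turns the deviation into a term of the supremum defining
   the variance of [X k]. *)
rewrite -ler_sqr ?nnegrE// real_normK ?num_real// -(ler_pM2r lamw).
have Psin : C / (e ^+ 2 * lam w) <= Psi n by near: n.
apply: (@le_trans _ _ (C * (n%:R ^+ 2 / Psi n))).
  rewrite -lee_fin; apply: (le_trans (poss_variance_ge _ _ _)).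
  (* The hypothesis is used at [n], not at [k]: one bound serves all [k <= n]. *)
  apply: (le_trans _ (VarX_le n n0)).
  exact: (le_running_max (fun k => poss_variance lam (X k))).
rewrite mulrA ler_pdivrMr ?Psi_gt0//.
have -> : (e * n%:R) ^+ 2 * lam w * Psi n
    = n%:R ^+ 2 * (Psi n * (e ^+ 2 * lam w)) by ring.
rewrite mulrC ler_wpM2l ?sqr_ge0// -ler_pdivrMr// mulr_gt0// exprn_gt0//.
Unshelve. all: by end_near.
Qed.
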